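(* Assume that $\bar s\neq 0$, $\mathrm{val}\,\mathrm{P}(\bar s)\in\mathbb{R}$, $\nu$ is lower semi-continuous at $\bar s$ and $\mathrm{Sol}\,\mathrm{D}(\bar s)\neq\emptyset$. Let $\{(x^k,y^k,\lambda^k)\}$ be generated by the augmented Lagrangian method, and let $s^k=y^k-g(x^k)$. Then: (i) The sequence $\{\|s^k\|\}$ is nonincreasing. (ii) The sequence $\{\mathrm{dist}(\lambda^k,\mathrm{Sol}\,\mathrm{D}(\bar s))\}$ is nonincreasing. (iii) If $r_k\ge\underline{r}$ for all $k$ for some $\underline{r}>0$, then $s^k\to\bar s$.
   Context: Standing setting: $\mathcal{Y}$ is a finite dimensional Hilbert space, $K\subset\mathcal{Y}$ is a nonempty closed convex set, $f:\mathbb{R}^n\to\mathbb{R}$ is convex and continuously differentiable, $g:\mathbb{R}^n\to\mathcal{Y}$ is continuously differentiable, and $G_K(x)=-g(x)+K$ is graph-convex, i.e. $\{(x,s)\in\mathbb{R}^n\times\mathcal{Y}: g(x)+s\in K\}$ is convex. $\mathcal{S}=\{s\in\mathcal{Y}:\exists x\in\mathbb{R}^n,\ g(x)+s\in K\}$ is assumed closed with $0\notin\mathcal{S}$, and $\bar s=\mathrm{argmin}\{\frac12\|s\|^2: s\in\mathcal{S}\}$. For $s\in\mathcal{Y}$, $\mathrm{P}(s)$ is the problem $\min f(x)$ s.t. $g(x)+s\in K$, with optimal value $\mathrm{val}\,\mathrm{P}(s)=\nu(s)=\inf\{f(x): g(x)+s\in K\}$ (with $\inf\emptyset=+\infty$).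 $\theta(\lambda)=-\inf_{x\in\mathbb{R}^n,\,y\in K}[f(x)+\langle\lambda,g(x)-y\rangle]$; $\mathrm{D}(s)$ is the dual problem $\max_{\lambda\in\mathcal{Y}}[\langle s,\lambda\rangle-\theta(\lambda)]$ and $\mathrm{Sol}\,\mathrm{D}(s)$ its set of optimal solutions. The augmented Lagrangian is $l_r(x,y,\lambda)=f(x)+\langle\lambda,g(x)-y\rangle+\frac r2\|g(x)-y\|^2$. Augmented Lagrangian method: start with $\lambda^0\in\mathcal{Y}$ and $r_0>0$; for $k=0,1,2,\dots$: (1) let $(x^{k+1},y^{k+1})$ be a solution of $\min_{x\in\mathbb{R}^n,\,y\in K}l_{r_k}(x,y,\lambda^k)$; (2) set $\lambda^{k+1}=\lambda^k+r_k(g(x^{k+1})-y^{k+1})$; (3) choose $r_{k+1}\ge r_k$. The generated infinite sequence is considered (no stopping); $x^k,y^k,s^k$ are indexed by $k\ge1$ and $\lambda^k$ by $k\ge0$. *)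

(* Defs.v *)
From HB Require Import structures.
From mathcomp Require Import all_boot all_order all_algebra.
From mathcomp Require Import all_classical all_reals all_analysis.

Set Implicit Arguments.
Unset Strict Implicit.
Unset Printing Implicit Defensive.

Import Order.TTheory GRing.Theory Num.Theory.
Import numFieldNormedType.Exports.

Local Open Scope classical_set_scope.
Local Open Scope ring_scope.

(* Completeness is not required separately, since it is automatic in finite
   dimension.  The norm of [Y] carries its topology, so closedness,
   convergence, differentiability and distances in [Y] all refer to [ip]. *)
Definition finite_dim_hilbert (R : realType) (Y : normedModType R)
    (ip : {dot Y for idfun}) : Prop :=
  (forall y : Y, `|y| = Num.sqrt (ip y y)) /\
  (exists (m : nat) (b : 'I_m -> Y),
     forall y : Y, exists c : 'I_m -> R, y = \sum_(i < m) c i *: b i).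

(* Differentiability everywhere, with a differential that is continuous for
   the operator norm.  The library's norm on ['rV[R]_n] is the sup norm; in
   finite dimension this choice does not affect the notion. *)
Definition continuously_differentiable (R : realType) (V W : normedModType R)
    (h : V -> W) : Prop :=
  (forall x : V, differentiable h x) /\
  (forall (x : V) (e : R), 0 < e ->
     \forall x' \near x,
       forall v : V, `|('d h x' : V -> W) v - ('d h x : V -> W) v| <= e * `|v|).

(* Pointwise version of the library's [lower_semicontinuous]. *)
Definition lower_semicontinuous_at (R : realType) (X : topologicalType)
    (h : X -> \bar R) (x : X) : Prop :=
  forall a : R, (a%:E < h x)%E -> \forall x' \near x, (a%:E < h x')%E.

Definition argmin (R : realType) (T : Type) (h : T -> R) (A : set T) : set T :=
  [set x | A x /\ forall x', A x' -> h x <= h x'].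

Section Problem.
Context (R : realType) (n : nat) (Y : normedModType R) (ip : {dot Y for idfun}).
Context (f : 'rV[R]_n -> R) (g : 'rV[R]_n -> Y) (K : set Y).

(* The graph of [x |-> - g x + K]. *)
Definition graph_G : set ('rV[R]_n * Y) := [set xs | K (g xs.1 + xs.2)].

Definition feasible_shifts : set Y := [set s | exists x, K (g x + s)].

Definition nu (s : Y) : \bar R :=
  ereal_inf [set (f x)%:E | x in [set x | K (g x + s)]].

Definition theta (lam : Y) : \bar R :=
  (- ereal_inf [set (f x + ip lam (g x - y))%:E | x in setT & y in K])%E.

Definition dual_obj (s lam : Y) : \bar R := ((ip s lam)%:E - theta lam)%E.

(* An optimal solution is required to have a finite objective value, so that
   there is none when the objective is identically -oo (infeasible dual). *)
Definition dual_sol (s : Y) : set Y :=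
  [set lam | dual_obj s lam \is a fin_num /\
             forall mu, (dual_obj s mu <= dual_obj s lam)%E].

Definition aug_lagrangian (r : R) (lam : Y) (xy : 'rV[R]_n * Y) : R :=
  f xy.1 + ip lam (g xy.1 - xy.2) + r / 2 * `|g xy.1 - xy.2| ^+ 2.

(* The iterates [x k], [y k] are meaningful for [k >= 1] only: the values at
   index 0 are unconstrained. *)
Record ALM_sequence (x : nat -> 'rV[R]_n) (y lam : nat -> Y) (r : nat -> R)
    : Prop := {
  ALM_r0_gt0 : 0 < r 0%N;
  ALM_step : forall k : nat,
    argmin (aug_lagrangian (r k) (lam k)) [set xy | K xy.2] (x k.+1, y k.+1);
  ALM_multiplier : forall k : nat,
    lam k.+1 = lam k + r k *: (g (x k.+1) - y k.+1);
  ALM_r_ndecr : forall k : nat, r k <= r k.+1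
}.

End Problem.

(* Main.v *)
Require Import Defs.
From HB Require Import structures.
From mathcomp Require Import all_boot all_order all_algebra.
From mathcomp Require Import lra.
From mathcomp Require Import all_classical all_reals all_analysis.

Set Implicit Arguments.
Unset Strict Implicit.
Unset Printing Implicit Defensive.

Import Order.TTheory GRing.Theory Num.Theory.
Import numFieldNormedType.Exports.

Local Open Scope classical_set_scope.
Local Open Scope ring_scope.

(** The method is the proximal point algorithm for the dual function [theta]:
    step [k] writes [lam k = lam k.+1 + r k *: s k.+1] with [s k.+1] a
    subgradient of [theta] at [lam k.+1]; concretely, the new iterate minimizes
    the ordinary Lagrangian at the new multiplier
    ([aug_lagrangian_minimizer]).  Everything else is monotonicity of the
    subdifferential of [theta].

    (i) Comparing two consecutive steps gives
    [ip (s k.+1) (s k.+1) <= ip (s k.+1) (s k)] for [1 <= k], hence the decrease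
    of the norms.

    (ii) The shift [sbar] is a subgradient of [theta] at every dual solution
    [mu] of the problem shifted by [sbar], but [mu] is not a fixed point of the
    proximal map since [sbar] is nonzero.  What saves the argument is that
    [sbar] is the projection of 0 on the feasible shifts: every feasible shift
    [s] satisfies [ip sbar sbar <= ip sbar s] ([least_norm_shift_dot]), so the
    dual solution set is stable under translation by [- t *: sbar]
    ([dual_sol_ray]).  Hence the proximal map sends the dual solution [mu] to
    the dual solution [mu - r k *: sbar], and, being firmly nonexpansive, it
    brings [lam k.+1] at least as close to the latter as [lam k] was to [mu]
    ([dual_sol_step]).

    (iii) Firm nonexpansiveness also leaves the surplus
    [(r k * `|s k.+1 - sbar|) ^+ 2].  Following one dual solution as it drifts
    along the ray, the surpluses telescope ([telescoping_cvg0]) and tend to 0;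
    the lower bound on [r k] then gives the convergence of [s]. *)

(** * The inner product *)

Section InnerProduct.
Context (R : realType) (Y : normedModType R) (ip : {dot Y for idfun}).

Lemma dotC u v : ip u v = ip v u.
Proof.
by have := hermC ip u v; rewrite expr0 mul1r.
Qed.

Lemma dotDl u v w : ip (u + v) w = ip u w + ip v w.
Proof. exact: linearDl. Qed.

Lemma dotNl u w : ip (- u) w = - ip u w.
Proof. exact: linearNl. Qed.

Lemma dotZl a u w : ip (a *: u) w = a * ip u w.
Proof. exact: linearZl_LR. Qed.

Lemma dotDr u v w : ip w (u + v) = ip w u + ip w v.
Proof. by rewrite dotC dotDl !(dotC w). Qed.

Lemma dotNr u w : ip w (- u) = - ip w u.
Proof. by rewrite dotC dotNl dotC. Qed.

Lemma dotZr a u w : ip w (a *: u) = a * ip w u.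
Proof. by rewrite dotC dotZl dotC. Qed.

Definition dotE := (dotDl, dotDr, dotNl, dotNr, dotZl, dotZr).

Lemma sqr_norm_dot (hY : finite_dim_hilbert ip) u : `|u| ^+ 2 = ip u u.
Proof.
have [-> _] := hY; rewrite sqr_sqrtr //.
have [->|u0] := eqVneq u 0; first by rewrite linear0l.
exact/ltW/neq0_dnorm_gt0.
Qed.

End InnerProduct.

(** * Real numbers, sequences and distances *)

Lemma unit_interval_num (R : realType) (t : R) :
  0 < t -> t <= 1 -> exists p : {i01 R}, p%:num = t.
Proof.
move=> t0 t1.
have ht : Itv.spec (@Itv.num_sem R) (Itv.Real `[0%Z, 1%Z]) t.
  by rewrite /= /Itv.num_sem num_real /= in_itv /= (ltW t0) t1.
by exists (Itv.mk ht).
Qed.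

(** The first-order optimality condition along a segment, in derivative-free
    form: dividing by [t] and letting [t] tend to 0 leaves [a]. *)
Lemma first_order_ge0 (R : realFieldType) (a b : R) :
  (forall t, 0 < t -> t <= 1 -> 0 <= t * a + t ^+ 2 * b) -> 0 <= a.
Proof.
move=> h; rewrite leNgt; apply/negP => a0.
have ab : 0 < `|a| + `|b| by rewrite ltr_wpDr// normr_gt0 lt_eqF.
(* Half the point where [t * a + t ^+ 2 * `|b|] vanishes, with [`|a|] added to
   the denominator so that it is nonzero and [t <= 1]. *)
pose t := `|a| / (2 * (`|a| + `|b|)).
have an0 : 0 < `|a| by rewrite normr_gt0 lt_eqF.
have t0 : 0 < t by rewrite divr_gt0// mulr_gt0.
have tE : t * (2 * (`|a| + `|b|)) = `|a|.
  by rewrite /t divfK// gt_eqF// mulr_gt0.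
have t1 : t <= 1.
  by rewrite ler_pdivrMr ?mulr_gt0// mul1r; have := normr_ge0 b; lra.
have := h t t0 t1.
rewrite expr2 -mulrA -mulrDr pmulr_rge0//.
have : t * b <= t * `|b| by rewrite ler_pM2l// ler_norm.
have : 0 < t * `|a| by rewrite mulr_gt0.
have : `|a| = - a by rewrite ltr0_norm.
rewrite mulrDr mulrDr in tE.
lra.
Qed.

Lemma telescoping_cvg0 (R : realType) (d e : nat -> R) :
  (forall k, 0 <= d k) -> (forall k, 0 <= e k) ->
  (forall k, d k.+1 + e k <= d k) -> e @ \oo --> 0.
Proof.
move=> d0 e0 de.
have dn : nonincreasing_seq d.
  by apply/nonincreasing_seqP => k; apply: le_trans (de k); rewrite lerDl.
have cd : cvgn d by apply: nonincreasing_is_cvgn => //; exists 0 => _ [k _ <-].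
have cd1 : (fun k => d k.+1) @ \oo --> limn d by rewrite (cvg_shiftS d).
apply: (@squeeze_cvgr _ _ _ _ (cst 0) (fun k => d k - d k.+1)).
- by near=> k; rewrite /= e0 /=; have := de k; lra.
- exact: cvg_cst.
- by rewrite -[0](subrr (limn d)); apply: cvgB.
Unshelve. all: by end_near. Qed.

Lemma le_edist (R : realType) (Y : normedModType R) (u v u' v' : Y) :
  `|u - v| <= `|u' - v'| -> (edist (u, v) <= edist (u', v'))%E.
Proof.
move=> h; apply: ereal_inf_le_tmp => _ [t [t0 /= b] <-]; exists t => //.
split => //=; move: b; rewrite -!ball_normE /=; exact: le_lt_trans.
Qed.

(** * Consequences of convexity *)

Section Problem.
Context (R : realType) (n : nat) (Y : normedModType R) (ip : {dot Y for idfun}).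
Context (f : 'rV[R]_n -> R) (g : 'rV[R]_n -> Y) (K : set Y).

(** The Lagrangian is parametrized by the shift [s] in place of the point
    [y = g x + s] of [K], so that [s] is a subgradient of [theta] at [lam]. *)
Definition lagrangian_minimizer (lam : Y) (x : 'rV[R]_n) (s : Y) : Prop :=
  K (g x + s) /\
  forall x' s', K (g x' + s') -> f x - ip lam s <= f x' - ip lam s'.

Lemma graph_segment (hG : convex_set (graph_G g K)) x s x' s' (t : R) :
  K (g x + s) -> K (g x' + s') -> 0 < t -> t <= 1 ->
  K (g (t *: x' + (1 - t) *: x) + (s + t *: (s' - s))).
Proof.
move=> k k' t0 t1.
have [p pE] := unit_interval_num t0 t1.
have /set_mem := hG (x', s') (x, s) p (mem_set k') (mem_set k).
rewrite /graph_G /= /conv /= pE.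
congr (K (_ + _)); rewrite scalerBr scalerBl scale1r.
by rewrite addrCA.
Qed.

Lemma convex_segment (hf : convex_function setT f) x x' (t : R) :
  0 < t -> t <= 1 ->
  f (t *: x' + (1 - t) *: x) <= f x + t * (f x' - f x).
Proof.
move=> t0 t1.
have [p pE] := unit_interval_num t0 t1.
have := hf p x' x (mem_set I) (mem_set I).
rewrite convRE /conv /= pE /unstable.onem; lra.
Qed.

(** The variational inequality of the projection of 0 on the convex set of
    feasible shifts. *)
Lemma least_norm_shift_dot (hY : finite_dim_hilbert ip)
    (hG : convex_set (graph_G g K)) sbar
    (hsbar : argmin (fun s : Y => 1 / 2 * `|s| ^+ 2) (feasible_shifts g K) sbar)
    x s :
  K (g x + s) -> ip sbar sbar <= ip sbar s.
Proof.
have [[x0 k0] hmin] := hsbar => k.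
suff : 0 <= 2 * (ip sbar s - ip sbar sbar) by lra.
apply: (@first_order_ge0 _ _ (ip (s - sbar) (s - sbar))) => t t0 t1.
have := hmin _ (ex_intro _ _ (graph_segment hG k0 k t0 t1)).
rewrite !(sqr_norm_dot hY) !dotE (dotC ip s sbar); nra.
Qed.

(** The quadratic penalty is smooth and the rest is convex in the pair of the
    point and the shift, so at a minimizer the penalty may be replaced by its
    linear part; this turns [lam] into the updated multiplier. *)
Lemma aug_lagrangian_minimizer (hY : finite_dim_hilbert ip)
    (hf : convex_function setT f) (hG : convex_set (graph_G g K))
    (r : R) (lam : Y) x y :
  argmin (aug_lagrangian ip f g r lam) [set xy | K xy.2] (x, y) ->
  lagrangian_minimizer (lam + r *: (g x - y)) x (y - g x).
Proof.
move=> [/= Ky hmin].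
set s := y - g x.
have sN : g x - y = - s by rewrite opprB.
have Ks : K (g x + s) by rewrite addrC subrK.
rewrite sN; clearbody s.
split => // x' s' Ks'.
suff : 0 <= f x' - f x - ip lam (s' - s) + r * ip s (s' - s).
  by rewrite !dotE; lra.
apply: (@first_order_ge0 _ _ (r / 2 * ip (s' - s) (s' - s))) => t t0 t1.
have kt := graph_segment hG Ks Ks' t0 t1.
have ft := convex_segment hf x x' t0 t1.
have := hmin (t *: x' + (1 - t) *: x, _) kt.
have subDK (a b : Y) : a - (a + b) = - b by rewrite opprD addrA subrr sub0r.
rewrite /aug_lagrangian /= sN subDK !normrN !(sqr_norm_dot hY).
rewrite !dotE (dotC ip s' s).
move: ft; set fs := f (_ + _) => ft h; nra.
Qed.

(** Monotonicity of the subdifferential of [theta]. *)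
Lemma lagrangian_minimizer_monotone lam lam' x x' s s' :
  lagrangian_minimizer lam x s -> lagrangian_minimizer lam' x' s' ->
  0 <= ip (lam - lam') (s - s').
Proof.
move=> [k h] [k' h']; have := h _ _ k'; have := h' _ _ k.
by rewrite !dotE; lra.
Qed.

(** * The dual solutions *)

Lemma theta_ge lam x s : K (g x + s) ->
  ((ip lam s - f x)%:E <= theta ip f g K lam)%E.
Proof.
move=> k; rewrite /theta leeNr -EFinN; apply: ereal_inf_lbound.
exists x => //; exists (g x + s) => //.
by rewrite opprD addrA subrr sub0r dotNr opprB.
Qed.

Lemma theta_le lam (c : R) :
  (forall x s, K (g x + s) -> ip lam s - f x <= c) ->
  (theta ip f g K lam <= c%:E)%E.
Proof.
move=> h; rewrite /theta leeNl -EFinN; apply: le_ereal_inf_tmp.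
move=> _ [x _] [y Ky <-].
rewrite lee_fin; have := h x (y - g x); rewrite addrC subrK => /(_ Ky).
by rewrite !dotE; lra.
Qed.

Lemma dual_sol_theta s lam : dual_sol ip f g K s lam ->
  exists c : R, theta ip f g K lam = c%:E.
Proof.
rewrite /dual_sol /dual_obj /=; case: (theta ip f g K lam) => [c _|[]//|[]//].
by exists c.
Qed.

(** Moving [lam] by [- t *: sbar] lowers the linear term of the dual objective
    by [t * ip sbar sbar], and lowers [ip lam s - f x] for every feasible shift
    [s], hence [theta], by at least as much. *)
Lemma dual_sol_ray sbar lam (t : R) :
  (forall x s, K (g x + s) -> ip sbar sbar <= ip sbar s) -> 0 <= t ->
  dual_sol ip f g K sbar lam -> dual_sol ip f g K sbar (lam - t *: sbar).
Proof.
move=> hproj t0 hlam; have [c hc] := dual_sol_theta hlam.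
have [fin hmax] := hlam.
have th : (theta ip f g K (lam - t *: sbar)%R <= (c - t * ip sbar sbar)%:E)%E.
  apply: theta_le => x s k.
  have := theta_ge lam k; rewrite hc lee_fin => h.
  have := ler_wpM2l t0 (hproj _ _ k); rewrite !dotE; lra.
have ge : (dual_obj ip f g K sbar lam
           <= dual_obj ip f g K sbar (lam - t *: sbar)%R)%E.
  rewrite /dual_obj hc.
  apply: (@le_trans _ _ ((ip sbar (lam - t *: sbar)%R)%:E
                         - (c - t * ip sbar sbar)%:E)%E).
    by rewrite -!EFinB lee_fin !dotE; lra.
  exact: leeB.
have eqo :
  dual_obj ip f g K sbar (lam - t *: sbar) = dual_obj ip f g K sbar lam.
  by apply/eqP; rewrite eq_le ge hmax.
by split => [|mu]; rewrite eqo.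
Qed.

(** Monotonicity of the subdifferential again, between [s] at [lam] and [sbar]
    at [lam'].  Since the infimum defining [nu] at [sbar] may not be attained,
    no minimizer of the Lagrangian at [lam'] is available with shift [sbar]; the
    subgradient inequality comes from the optimality of [lam'] instead. *)
Lemma dual_sol_monotone sbar lam lam' x s :
  lagrangian_minimizer lam x s -> dual_sol ip f g K sbar lam' ->
  0 <= ip (lam - lam') (s - sbar).
Proof.
move=> [k h] hlam'; have [c hc] := dual_sol_theta hlam'.
have := theta_ge lam' k; rewrite hc lee_fin => h1.
have th : (theta ip f g K lam <= (ip lam s - f x)%:E)%E.
  by apply: theta_le => x' s' k'; have := h _ _ k'; lra.
have := hlam'.2 lam; rewrite /dual_obj hc => h2.
have : ((ip sbar lam)%:E - (ip lam s - f x)%:E <= (ip sbar lam')%:E - c%:E)%E.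
  by apply: le_trans h2; apply: leeB.
rewrite -!EFinB lee_fin !dotE (dotC ip sbar lam) (dotC ip sbar lam').
lra.
Qed.

(** Firm nonexpansiveness of the proximal map of [theta], which sends [lam] to
    [lam'] and [mu] to [mu - r *: sbar]: the squared distance on the right is
    the sum of the two squares on the left and of twice a cross term that is
    nonnegative by monotonicity. *)
Lemma dual_sol_step (hY : finite_dim_hilbert ip) sbar mu (lam lam' : Y)
    (r : R) x s :
  (forall x s, K (g x + s) -> ip sbar sbar <= ip sbar s) -> 0 <= r ->
  lam' = lam - r *: s -> lagrangian_minimizer lam' x s ->
  dual_sol ip f g K sbar mu ->
  `|lam' - (mu - r *: sbar)| ^+ 2 + (r * `|s - sbar|) ^+ 2 <= `|lam - mu| ^+ 2.
Proof.
move=> hproj r0 lamE hmin hmu.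
have h := dual_sol_monotone hmin (dual_sol_ray hproj r0 hmu).
have -> : lam - mu = (lam' - (mu - r *: sbar)) + r *: (s - sbar).
  rewrite lamE scalerBr; move: (r *: s) (r *: sbar) => a b.
  by rewrite opprB addrACA subrK [b - mu]addrC addrK.
move: (lam' - _) (s - sbar) h => d e h.
rewrite exprMn !(sqr_norm_dot hY) !dotE (dotC ip e d).
have := mulr_ge0 r0 h; nra.
Qed.

End Problem.

(** * Convergence of the method *)

Theorem theorem4p2 (R : realType) (n : nat) (Y : normedModType R)
    (ip : {dot Y for idfun}) (f : 'rV[R]_n -> R) (g : 'rV[R]_n -> Y)
    (K : set Y) (sbar : Y)
    (x : nat -> 'rV[R]_n) (y lam : nat -> Y) (r : nat -> R)
    (hY : finite_dim_hilbert ip)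
    (hK0 : K !=set0) (hKclosed : closed K) (hKconvex : convex_set K)
    (hfconvex : convex_function setT f)
    (hfC1 : continuously_differentiable f)
    (hgC1 : continuously_differentiable g)
    (hG : convex_set (graph_G g K))
    (hSclosed : closed (feasible_shifts g K))
    (hS0 : ~ feasible_shifts g K 0)
    (hsbar : argmin (fun s : Y => 1 / 2 * `|s| ^+ 2) (feasible_shifts g K) sbar)
    (hsbar0 : sbar != 0)
    (hval : nu f g K sbar \is a fin_num)
    (hlsc : lower_semicontinuous_at (nu f g K) sbar)
    (hsol : dual_sol ip f g K sbar !=set0)
    (hALM : ALM_sequence ip f g K x y lam r) :
  let s := fun k : nat => y k - g (x k) in
  [/\ forall k : nat, (1 <= k)%N -> `|s k.+1| <= `|s k|,
      forall k : nat, (edist_inf (dual_sol ip f g K sbar) (lam k.+1)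
                       <= edist_inf (dual_sol ip f g K sbar) (lam k))%E
    & (exists2 rlow : R, 0 < rlow & forall k : nat, rlow <= r k) ->
      s @ \oo --> sbar].
Proof.
move=> s.
have hproj := least_norm_shift_dot hY hG hsbar.
have r_gt0 k : 0 < r k.
  elim: k => [|k IHk]; first exact: ALM_r0_gt0 hALM.
  exact: lt_le_trans IHk (ALM_r_ndecr hALM k).
have lamE k : lam k.+1 = lam k - r k *: s k.+1.
  by rewrite (ALM_multiplier hALM) -scalerN opprB.
have smin k : lagrangian_minimizer ip f g K (lam k.+1) (x k.+1) (s k.+1).
  rewrite (ALM_multiplier hALM).
  exact: aug_lagrangian_minimizer (ALM_step hALM k).
have step k mu : dual_sol ip f g K sbar mu ->
    `|lam k.+1 - (mu - r k *: sbar)| ^+ 2 + (r k * `|s k.+1 - sbar|) ^+ 2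
      <= `|lam k - mu| ^+ 2.
  move=> hmu.
  exact (dual_sol_step hY hproj (ltW (r_gt0 k)) (lamE k) (smin k) hmu).
split.
- case=> // k _.
  rewrite -(ler_pXn2r (n := 2))// ?nnegrE// !(sqr_norm_dot hY).
  have : 0 <= ip (s k.+2 - s k.+1) (s k.+2 - s k.+1).
    by rewrite -(sqr_norm_dot hY) sqr_ge0.
  have := lagrangian_minimizer_monotone (smin k.+1) (smin k).
  have -> : lam k.+2 - lam k.+1 = - (r k.+1 *: s k.+2).
    by rewrite (lamE k.+1) addrAC subrr add0r.
  rewrite dotNl dotZl -mulrN pmulr_rge0//.
  move: (s k.+1) (s k.+2) => a b.
  rewrite !dotE (dotC ip a b); lra.
- move=> k; apply: le_ereal_inf_tmp => _ [mu hmu <-].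
  apply: (@le_trans _ _ (edist (lam k.+1, mu - r k *: sbar))).
    apply: ereal_inf_lbound; exists (mu - r k *: sbar) => //.
    exact: dual_sol_ray hproj (ltW (r_gt0 k)) hmu.
  apply: le_edist; rewrite -(ler_pXn2r (n := 2))// ?nnegrE//.
  by apply: le_trans (step k mu hmu); rewrite lerDl sqr_ge0.
- case=> rlow rlow0 hr.
  have [mu hmu] := hsol.
  (* The dual solution [mu] after it has been moved along by the first [k]
     proximal steps. *)
  pose mus k := mu - (\sum_(i < k) r i) *: sbar.
  have musS k : mus k.+1 = mus k - r k *: sbar.
    by rewrite /mus big_ord_recr /= scalerDl opprD addrA.
  have hmus k : dual_sol ip f g K sbar (mus k).
    apply: dual_sol_ray hproj _ hmu.
    by apply: sumr_ge0 => i _; exact: ltW.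
  have : (fun k => (r k * `|s k.+1 - sbar|) ^+ 2) @ \oo --> 0.
    apply: (@telescoping_cvg0 _ (fun k => `|lam k - mus k| ^+ 2)) => k.
    + exact: sqr_ge0.
    + exact: sqr_ge0.
    + by rewrite musS; exact: step.
  move=> /cvgr0_norm_lt h.
  rewrite -(cvg_shiftS s); apply/cvgrPdist_lt => e e0.
  have he : 0 < (rlow * e) ^+ 2 by rewrite exprn_gt0 ?mulr_gt0.
  near=> k.
  rewrite distrC -(ltr_pM2l rlow0).
  apply: (@le_lt_trans _ _ (r k * `|s k.+1 - sbar|)).
    by rewrite ler_wpM2r.
  rewrite -(ltr_pXn2r (n := 2))// ?nnegrE ?mulr_ge0//;
    rewrite ?(ltW (r_gt0 _)) ?(ltW rlow0) ?(ltW e0)//.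
  rewrite -[ltLHS]ger0_norm ?sqr_ge0//.
  near: k; exact: h.
Unshelve. all: by end_near. Qed.
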